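(* Let $n\ge2$. The set of negatively associated probability measures on the Boolean cube $I_n=\{0,1\}^n$ is not convex.
   Context: A function of several $\{0,1\}$-valued coordinates is non-decreasing if it is so with respect to the coordinatewise order; $x_I$ is the restriction of $x$ to coordinates in $I\subset\{1,\dots,n\}$. A probability measure $\mu$ on $I_n$ is negatively associated (NA) if $\int f(x_I)g(x_J)\,d\mu\le\int f(x_I)\,d\mu\int g(x_J)\,d\mu$ for all disjoint $I,J\subset\{1,\dots,n\}$ and all non-decreasing $f:\{0,1\}^{I}\to\mathbb{R}$, $g:\{0,1\}^{J}\to\mathbb{R}$. Convexity is with respect to convex combinations $\lambda\mu+(1-\lambda)\nu$, $0\le\lambda\le1$, of measures. *)

(* Defs.v *)
From HB Require Import structures.
From mathcomp Require Import all_boot all_order all_algebra.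
From mathcomp Require Import all_classical all_reals all_analysis.

Set Implicit Arguments.
Unset Strict Implicit.
Unset Printing Implicit Defensive.
Import Order.TTheory GRing.Theory Num.Theory.
Local Open Scope classical_set_scope.
Local Open Scope ring_scope.

(* The Boolean cube {0,1}^K over a finite index type K, with the power set as
   sigma-algebra, so that every function on it is measurable. *)
Definition cube (K : finType) : Type := {ffun K -> bool}.

HB.instance Definition _ (K : finType) := Finite.on (cube K).
HB.instance Definition _ (K : finType) :=
  isPointed.Build (cube K) [ffun=> false].
HB.instance Definition _ (K : finType) := @isMeasurable.Build
  default_measure_display (cube K) (@discrete_measurable (cube K))
  (@discrete_measurable0 _) (@discrete_measurableC _)
  (@discrete_measurableU _).

Definition cube_app (K : finType) (x : cube K) : K -> bool :=
  fun_of_fin (x : {ffun K -> bool}).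
Coercion cube_app : cube >-> Funclass.

Definition cube_le (K : finType) (x y : cube K) : Prop :=
  forall k : K, x k ==> y k.

Definition cube_nondecreasing (R : realType) (K : finType)
    (f : cube K -> R) : Prop :=
  forall x y : cube K, cube_le x y -> f x <= f y.

Definition cube_restr (n : nat) (I : {set 'I_n}) (x : cube 'I_n) :
    cube {i : 'I_n | i \in I} :=
  [ffun i => x (val i)].

Definition negatively_associated (R : realType) (n : nat)
    (mu : probability (cube 'I_n) R) : Prop :=
  forall (I J : {set 'I_n})
         (f : cube {i : 'I_n | i \in I} -> R)
         (g : cube {j : 'I_n | j \in J} -> R),
    [disjoint I & J]%B -> cube_nondecreasing f -> cube_nondecreasing g ->
    (\int[mu]_x (f (cube_restr I x) * g (cube_restr J x))%:E <=
     (\int[mu]_x (f (cube_restr I x))%:E) *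
     (\int[mu]_x (g (cube_restr J x))%:E))%E.

Section mixture.
Context d (T : measurableType d) (R : realType).
Variables (l : {i01 R}) (mu nu : probability T R).

Lemma onem_i01_ge0 : 0 <= 1 - l%:num.
Proof. by rewrite subr_ge0 le1. Qed.

(* The measure l mu + (1 - l) nu. *)
Definition mixture : set T -> \bar R :=
  measure_add (mscale (NngNum (ge0 l)) mu) (mscale (NngNum onem_i01_ge0) nu).

HB.instance Definition _ := Measure.on mixture.

Let mixture_setT : mixture setT = 1%E.
Proof.
rewrite /mixture measure_addE /= /mscale /= !probability_setT !mule1.
by rewrite -EFinD subrKC.
Qed.

HB.instance Definition _ :=
  @Measure_isProbability.Build _ _ _ mixture mixture_setT.

Lemma mixtureE (A : set T) :
  mixture A = (l%:num%:E * mu A + (1 - l%:num)%:E * nu A)%E.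
Proof. by rewrite /mixture measure_addE. Qed.

End mixture.

(* [convex_set] of the library is only available in an lmodType, which the
   type of probability measures is not. *)
Definition convex_probabilities d (T : measurableType d) (R : realType)
    (S : set (probability T R)) : Prop :=
  forall (mu nu : probability T R) (l : {i01 R}),
    S mu -> S nu -> S (mixture l mu nu).

(* Main.v *)
Require Import Defs.
From mathcomp Require Import all_boot all_order all_algebra.
From mathcomp Require Import all_classical all_reals all_analysis.
Local Open Scope classical_set_scope.

(** Negative association compares an expectation, which is affine in the
    measure, with a product of two expectations, which is quadratic in it, so
    mixing two measures can create a positive correlation that neither of them
    has.  A point mass satisfies the
    inequality with equality, since under it every function is constant
    ([negatively_associated_dirac]).  The mixture with equal weights of the
    point masses at the all-ones and the all-zeros points makes any two
    coordinates equal to the same fair coin: the product of two distinct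
    coordinates, which exist as 2 <= n, has expectation 1/2, whereas the
    product of their expectations is only 1/4.  So the extreme points of the
    simplex of all probability measures are negatively associated, but the
    midpoint of two of them is not. *)

Import Order.TTheory GRing.Theory Num.Theory.
Local Open Scope ring_scope.

Lemma cube_measurable_fun (K : finType) (d : measure_display)
    (U : sigmaRingType d) (D : set (cube K)) (f : cube K -> U) :
  measurable_fun D f.
Proof. by []. Qed.

Lemma negatively_associated_dirac (R : realType) (n : nat) (a : cube 'I_n) :
  negatively_associated (\d_a : probability (cube 'I_n) R).
Proof.
move=> I J f g _ _ _.
rewrite !integral_dirac //; try exact: cube_measurable_fun.
by rewrite !diracT !mul1e EFinM.
Qed.

(** Nonnegativity of [f] lets the integral split over the sum of measures
    without any integrability condition. *)
Lemma ge0_integral_mixture_dirac (R : realType) (K : finType) (l : {i01 R})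
    (a b : cube K) (f : cube K -> R) : (forall x, 0 <= f x) ->
  (\int[mixture l (\d_a : probability (cube K) R) \d_b]_x (f x)%:E =
   (l%:num * f a + (1 - l%:num) * f b)%:E)%E.
Proof.
move=> f0.
have f0E x : setT x -> (0 <= (f x)%:E)%E by rewrite lee_fin.
rewrite ge0_integral_measure_add // !ge0_integral_mscale //=;
  try exact: cube_measurable_fun.
rewrite !integral_dirac //; try exact: cube_measurable_fun.
by rewrite !diracT !mul1e.
Qed.

Lemma cube_nondecreasing_coord (R : realType) (K : finType) (k : K) :
  cube_nondecreasing (fun x : cube K => (x k)%:R : R).
Proof. by move=> x y /(_ k); case: (x k); case: (y k). Qed.

Lemma cube_restrE (n : nat) (I : {set 'I_n}) (x : cube 'I_n)
    (i : {i : 'I_n | i \in I}) : cube_restr I x i = x (val i).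
Proof. by rewrite /cube_restr /cube_app ffunE. Qed.

(** For refuting negative association it is enough to look at one pair of
    coordinates: each of them is a nondecreasing function of itself. *)
Lemma negatively_associated_coord (R : realType) (n : nat)
    (mu : probability (cube 'I_n) R) (i j : 'I_n) :
  negatively_associated mu -> i != j ->
  (\int[mu]_x ((x i)%:R * (x j)%:R : R)%:E <=
   (\int[mu]_x ((x i)%:R : R)%:E) * (\int[mu]_x ((x j)%:R : R)%:E))%E.
Proof.
move=> NA ij.
have disj : [disjoint [set i]%SET & [set j]%SET]%B.
  by rewrite disjoints1 inE.
have := NA _ _ _ _ disj
  (cube_nondecreasing_coord R _ (Sub i (set11 i)))
  (cube_nondecreasing_coord R _ (Sub j (set11 j))).
by under eq_integral do rewrite !cube_restrE /=;
   under [X in (_ <= X * _)%E -> _]eq_integral do rewrite cube_restrE /=;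
   under [X in (_ <= _ * X)%E -> _]eq_integral do rewrite cube_restrE /=.
Qed.

Theorem corollary4 (R : realType) (n : nat) (hn : (2 <= n)%N) :
  ~ convex_probabilities
      [set mu : probability (cube 'I_n) R | negatively_associated mu].
Proof.
move=> conv.
pose i := Ordinal (ltnW hn); pose j := Ordinal hn.
pose one : cube 'I_n := [ffun=> true]; pose zero : cube 'I_n := [ffun=> false].
have half_ge0 : (0 : R) <= 2^-1 by rewrite invr_ge0.
have half_le1 : (2^-1 : R) <= 1 by rewrite invf_le1 // ler1n.
pose half : {i01 R} := Itv01 half_ge0 half_le1.
have NA := conv \d_one \d_zero half
  (@negatively_associated_dirac R n one) (@negatively_associated_dirac R n zero).
(* The inequality for coordinates 0 and 1 would read 1/2 <= 1/2 * 1/2. *)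
have /(_ isT) := @negatively_associated_coord _ _ _ i j NA.
rewrite !ge0_integral_mixture_dirac //; try by move=> x; rewrite ?mulr_ge0.
rewrite /cube_app !ffunE -EFinM lee_fin /= !mulr1 !mulr0 !addr0.
by rewrite ler_pMr ?invr_gt0 // invf_ge1 // leNgt ltr1n.
Qed.
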